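(* Let $n\ge 11$ and $k$ be positive integers and let $d=n-(2k-1)$ satisfy $3\le d\le n-7$. Let $T_{n,d}=\frac{n(n+1)}{2}-d$. Then \[ \#\mathbb U^*_{T_{n,d}}=1+\#\mathbb D_k. \]
   Context: A partition of $N$ into distinct parts is a sequence of positive integers $\lambda_1<\dots<\lambda_t$ summing to $N$ with $t\ge 2$ (the one-part sequence $(N)$ is not counted); $\mathbb D_N$ is the set of these. Missing parts of $\lambda$: elements of $\{1,\dots,\lambda_t\}\setminus\{\lambda_1,\dots,\lambda_t\}$. $\lambda$ is refinable if two distinct missing parts sum to a part of $\lambda$, unrefinable otherwise; $\mathbb U_N$ is the set of unrefinable partitions of $N$. $\mathbb U^*_N$ is the set of $\lambda\in\mathbb U_N$ whose largest part is the maximum of the largest parts over all of $\mathbb U_N$. Standing assumption: $n\ge 11$. *)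

(* Defs.v *)
From mathcomp Require Import all_boot.

Set Implicit Arguments.
Unset Strict Implicit.
Unset Printing Implicit Defensive.

(* A partition is the increasing sequence of its parts, smallest first. *)
Definition is_dpartition (N : nat) (s : seq nat) : bool :=
  [&& sorted ltn s, all (ltn 0) s, sumn s == N & 2 <= size s].

Definition largest_part (s : seq nat) : nat := last 0 s.

Definition missing_parts (s : seq nat) : seq nat :=
  [seq m <- iota 1 (largest_part s) | m \notin s].

Definition refinable (s : seq nat) : bool :=
  has (fun a => has (fun b => (a != b) && (a + b \in s)) (missing_parts s))
      (missing_parts s).

Definition unrefinable (s : seq nat) : bool := ~~ refinable s.

(* A partition of N into distinct parts has at most N parts, each at most N,
   so all of them live in this finite type; see is_dpartition_bounded. *)
Definition bounded_seq (N : nat) : finType := N.-bseq 'I_N.+1.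

Definition parts (N : nat) (lam : bounded_seq N) : seq nat :=
  [seq val i | i <- val lam].

Definition distinct_partitions (N : nat) : {set bounded_seq N} :=
  [set lam | is_dpartition N (parts lam)].

Definition unrefinable_partitions (N : nat) : {set bounded_seq N} :=
  [set lam in distinct_partitions N | unrefinable (parts lam)].

Definition max_unrefinable_partitions (N : nat) : {set bounded_seq N} :=
  [set lam in unrefinable_partitions N |
    largest_part (parts lam)
      == \max_(mu in unrefinable_partitions N) largest_part (parts mu)].

Notation "''D_' N" := (distinct_partitions N)
  (at level 8, N at level 2, format "''D_' N") : nat_scope.
Notation "''U_' N" := (unrefinable_partitions N)
  (at level 8, N at level 2, format "''U_' N") : nat_scope.
Notation "''U*_' N" := (max_unrefinable_partitions N)
  (at level 8, N at level 2, format "''U*_' N") : nat_scope.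

Definition T_ (n d : nat) : nat := n * (n + 1) %/ 2 - d.

Lemma parts_inj (N : nat) : injective (@parts N).
Proof.
by move=> lam mu /(inj_map val_inj) eq_lm; apply: val_inj.
Qed.

Lemma is_dpartition_bounded (N : nat) (s : seq nat) :
  is_dpartition N s -> exists2 lam, lam \in 'D_N & parts lam = s.
Proof.
move=> dps; case/and4P: (dps) => _ pos_s /eqP sumN _.
have size_s : size [seq inord i : 'I_N.+1 | i <- s] <= N.
  rewrite size_map -sumN; elim: s pos_s {dps sumN} => //= x s IHs /andP[x0 /IHs].
  by move=> le_s; rewrite -add1n leq_add.
have sE : parts (Bseq size_s : bounded_seq N) = s.
  rewrite /parts /= -map_comp -[RHS]map_id; apply/eq_in_map => i /= si.
  rewrite inordK // ltnS -sumN; elim: s si {dps pos_s sumN size_s} => //= x s IHs.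
  rewrite inE => /orP[/eqP->|/IHs le_i]; first exact: leq_addr.
  exact: leq_trans le_i (leq_addl _ _).
by exists (Bseq size_s) => //; rewrite inE sE.
Qed.

(* Main.v *)
Require Import Defs.
From mathcomp Require Import all_boot zify.

(* Put h = n - 2. In an unrefinable partition with largest part L, every pair
   {a, L - a} with a < L - a contains a part; summing the smaller members
   exceeds T_{n,d} as soon as L > 2h. For L = 2h, comparing the sum with that
   of {1, ..., h - 1, 2h} leaves an excess of exactly 2k <= h. A pair containing
   two parts would contribute more than h, so (unless h is a part, which forces
   {1, ..., h, 2h} and h = 2k) the partition is obtained by moving some parts
   h - p to h + p, where the distinct numbers p sum to k. All such choices are
   unrefinable, except the single number p = k when h = 2k; thus for both
   h > 2k and h = 2k there is exactly one partition besides those given by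
   D_k. *)

(** * Interval sums and sorted sequences of parts *)

Lemma sumn_filter_iota (p : pred nat) n :
  sumn [seq x <- iota 1 n | p x] = \sum_(1 <= x < n.+1) p x * x.
Proof.
rewrite sumnE big_filter /index_iota subn1 big_mkcond /=.
by apply: eq_bigr => x _; case: (p x); rewrite ?mul1n.
Qed.

(** Pairing [a] with its mirror [L - a] prepares for unrefinability, which constrains exactly such
    pairs when [L] is a part. *)
Lemma sum_nat_fold (f : nat -> nat) m L : m.*2 < L ->
  \sum_(1 <= x < L) f x
    = \sum_(1 <= a < m.+1) (f a + f (L - a)) + \sum_(m.+1 <= x < L - m) f x.
Proof.
elim: m => [|m IHm] ltmL; first by rewrite subn0 (@big_geq _ _ _ 1 1).
rewrite IHm; last by lia.
rewrite [in RHS]big_nat_recr //= -addnA; congr (_ + _).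
have -> : L - m = (L - m.+1).+1 by lia.
by rewrite big_ltn ?big_nat_recr /=; lia.
Qed.

Lemma sorted_ltn_last s x : sorted ltn s -> x \in s -> x <= last 0 s.
Proof.
elim/last_ind: s => // s y _.
rewrite -rev_sorted rev_rcons last_rcons mem_rcons inE /=.
rewrite (path_sortedE (rev_trans ltn_trans)) => /andP[/allP lt_y _].
by case/predU1P=> [-> // | sx]; apply/ltnW/lt_y; rewrite mem_rev.
Qed.

Lemma mem_last0 s : 0 < last 0 s -> last 0 s \in s.
Proof. by case: s => //= x s _; exact: mem_last. Qed.

Lemma sorted_ltn_filter_iota s :
  sorted ltn s -> all (ltn 0) s -> s = [seq x <- iota 1 (last 0 s) | x \in s].
Proof.
move=> sorted_s /allP pos_s; apply: (irr_sorted_eq ltn_trans ltnn) => //.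
  exact/(sorted_filter ltn_trans)/iota_ltn_sorted.
move=> x; rewrite mem_filter mem_iota.
case sx: (x \in s) => //=; have := sorted_ltn_last _ _ sorted_s sx.
by have /= := pos_s x sx; lia.
Qed.

(** * Unrefinability and pairs summing to the largest part *)

Lemma unrefinableP s : sorted ltn s ->
  reflect (forall a b, 0 < a -> 0 < b -> a != b ->
             a \notin s -> b \notin s -> a + b \notin s)
          (unrefinable s).
Proof.
move=> sorted_s; apply: (iffP hasPn) => [unref a b a0 b0 ab sa sb | unref a].
  apply/negP=> sab; have := sorted_ltn_last _ _ sorted_s sab => leab.
  have /unref/hasPn/(_ b) : a \in missing_parts s.
    by rewrite mem_filter sa mem_iota /largest_part; lia.
  by rewrite mem_filter sb mem_iota /largest_part ab sab /=; lia.
rewrite mem_filter mem_iota => /and3P[sa a0 _]; apply/hasPn=> b.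
rewrite mem_filter mem_iota => /and3P[sb b0 _].
by rewrite negb_and; case: eqP => //= /eqP ab; apply: unref.
Qed.

Lemma sumn_fold s h : sorted ltn s -> all (ltn 0) s -> last 0 s = h.*2 ->
  0 < h ->
  sumn s = h.*2 + (h \in s) * h
    + \sum_(1 <= a < h) ((a \in s) * a + (h.*2 - a \in s) * (h.*2 - a)).
Proof.
move=> sorted_s pos_s last_s h0.
have s2h : h.*2 \in s by rewrite -last_s mem_last0 // last_s; lia.
rewrite {1}(sorted_ltn_filter_iota s) // last_s sumn_filter_iota.
rewrite big_nat_recr /=; last by lia.
(* Folding [h.-1] pairs leaves a single middle term, [h], which is its own mirror. *)
rewrite (sum_nat_fold _ h.-1); last by lia.
rewrite s2h prednK //.
have -> : h.*2 - h.-1 = h.+1 by lia.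
by rewrite big_nat1; lia.
Qed.

(* Each of the [h] pairs [a], [L - a] contains a part. *)
Lemma unrefinable_last_bound s h : sorted ltn s -> all (ltn 0) s ->
  unrefinable s -> h.*2 < last 0 s ->
  \sum_(1 <= a < h.+1) a + last 0 s <= sumn s.
Proof.
move=> sorted_s pos_s /(unrefinableP _ sorted_s) unref.
move EL: (last 0 s) => L ltL.
have sL : L \in s by rewrite -EL mem_last0 // EL; lia.
rewrite [in leqRHS](sorted_ltn_filter_iota s) // sumn_filter_iota EL.
rewrite [in leqRHS]big_nat_recr /=; last by lia.
rewrite sL mul1n leq_add2r [in leqRHS](sum_nat_fold _ h) //.
apply: leq_trans (leq_addr _ _).
rewrite big_nat [leqRHS]big_nat; apply: leq_sum => a /andP[a0 leah].
have := unref a (L - a); have -> : a + (L - a) = L by lia.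
rewrite sL; case: (a \in s) => /=; first by lia.
case: (L - a \in s) => //=; [lia|].
by move=> /(_ a0) sum_notin; apply: contraT => _; apply: sum_notin; lia.
Qed.

(** * Shifting parts across [h] *)

(* The partition with largest part [h.*2] obtained from [1, ..., h.-1, h.*2] by
   moving each part [h - p], [p \in P], to [h + p]. *)
Definition shift_parts (h : nat) (P : seq nat) : seq nat :=
  [seq x <- iota 1 h.*2 | if x < h then h - x \notin P else x - h \in h :: P].

(** Recovers [P] from [shift_parts h P]. The range stops at [h.-1] so that the largest part [h.*2]
    does not count as a shift. *)
Definition shifts (h : nat) (s : seq nat) : seq nat :=
  [seq p <- iota 1 h.-1 | h + p \in s].

Lemma mem_shift_parts h P x : x \in shift_parts h P =
  (0 < x <= h.*2) && (if x < h then h - x \notin P else x - h \in h :: P).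
Proof. by rewrite mem_filter mem_iota add1n ltnS andbC. Qed.

Lemma shift_parts_sorted h P : sorted ltn (shift_parts h P).
Proof. exact/(sorted_filter ltn_trans)/iota_ltn_sorted. Qed.

Lemma shift_parts_gt0 h P : all (ltn 0) (shift_parts h P).
Proof. by apply/allP=> x; rewrite mem_shift_parts => /andP[/andP[]]. Qed.

Lemma last_shift_parts h P : 0 < h -> last 0 (shift_parts h P) = h.*2.
Proof.
move=> h0; have E : h.*2.-1 + 1 = h.*2 by lia.
rewrite /shift_parts -[in iota _ _]E iotaD cats1 filter_rcons [1 + _]addnC E.
have -> : h.*2 < h = false by lia.
have -> : h.*2 - h = h by lia.
by rewrite inE eqxx last_rcons.
Qed.

Lemma shiftsK h P : sorted ltn P -> all (ltn 0) P -> all (gtn h) P ->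
  shifts h (shift_parts h P) = P.
Proof.
move=> sorted_P /allP pos_P /allP lt_P.
apply: (irr_sorted_eq ltn_trans ltnn) => //.
  exact/(sorted_filter ltn_trans)/iota_ltn_sorted.
move=> x; rewrite mem_filter mem_iota mem_shift_parts inE addKn.
have -> : h + x < h = false by lia.
case Px: (x \in P); last by rewrite orbF; lia.
by have /= := pos_P x Px; have /= := lt_P x Px; lia.
Qed.

(** Reindexing by [a = h - p], the smaller member of the pair, matches the folded sum of parts. *)
Lemma sumn_shifts h s :
  sumn (shifts h s) = \sum_(1 <= a < h) (h.*2 - a \in s) * (h - a).
Proof.
rewrite sumn_filter_iota; case: h => [|h]; first by rewrite !big_geq.
rewrite big_nat_rev; apply: eq_big_nat => a /= /andP[a0 leah].
by congr (nat_of_bool (_ \in s) * _); lia.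
Qed.

Lemma mem_shifts h s p : p \in shifts h s = (0 < p < h) && (h + p \in s).
Proof. by rewrite mem_filter mem_iota andbC; congr (_ && _); lia. Qed.

Lemma shifts_sorted h s : sorted ltn (shifts h s).
Proof. exact/(sorted_filter ltn_trans)/iota_ltn_sorted. Qed.

Lemma shifts_gt0 h s : all (ltn 0) (shifts h s).
Proof. by apply/allP=> p; rewrite mem_shifts => /andP[/andP[]]. Qed.

(** With exactly one part per pair, choosing [h + p] instead of [h - p] adds [p.*2]. *)
Lemma sumn_balanced s h : sorted ltn s -> all (ltn 0) s -> last 0 s = h.*2 ->
  0 < h -> h \notin s ->
  (forall a, 0 < a < h -> (a \in s) = (h.*2 - a \notin s)) ->
  sumn s = \sum_(1 <= a < h) a + h.*2 + (sumn (shifts h s)).*2.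
Proof.
move=> sorted_s pos_s last_s h0 sh bal.
rewrite (sumn_fold _ h) // (negPf sh) mul0n addn0 [LHS]addnC addnAC.
congr (_ + _).
rewrite sumn_shifts -[(bigop _ _ _).*2]mul2n big_distrr -big_split /=.
apply: eq_big_nat => a lta; rewrite bal //.
by case: (_ \in s) => /=; lia.
Qed.

Lemma sumn_shift_parts h P :
  sorted ltn P -> all (ltn 0) P -> all (gtn h) P -> 0 < h ->
  sumn (shift_parts h P) = \sum_(1 <= a < h) a + h.*2 + (sumn P).*2.
Proof.
move=> sorted_P pos_P lt_P h0.
rewrite (sumn_balanced _ h) ?shift_parts_sorted ?shift_parts_gt0
  ?last_shift_parts ?shiftsK //.
  rewrite mem_shift_parts ltnn subnn inE.
  case P0: (0 \in P); first by have /= := allP pos_P 0 P0.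
  by lia.
move=> a /andP[a0 ltah]; rewrite !mem_shift_parts ltah inE.
have -> : h.*2 - a < h = false by lia.
have -> : h.*2 - a - h = h - a by lia.
by case: (h - a \in P); lia.
Qed.

Lemma shifts_shift_parts s h : sorted ltn s -> all (ltn 0) s ->
  last 0 s = h.*2 -> 0 < h -> h \notin s ->
  (forall a, 0 < a < h -> (a \in s) = (h.*2 - a \notin s)) ->
  s = shift_parts h (shifts h s).
Proof.
move=> sorted_s pos_s last_s h0 sh bal.
rewrite {1}(sorted_ltn_filter_iota s) // last_s.
apply: eq_in_filter => /= x; rewrite mem_iota inE !mem_shifts => ltx.
case: ltnP => ltxh.
  rewrite (bal x); last by lia.
  have -> : h + (h - x) = h.*2 - x by lia.
  by case: (_ \in s); lia.
rewrite subnKC //; case: (eqVneq x h) => [->|xh].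
  by rewrite subnn (negPf sh); lia.
case: (eqVneq x h.*2) => [->|x2h]; last by case: (x \in s); lia.
have -> : h.*2 \in s by rewrite -last_s mem_last0 // last_s; lia.
by lia.
Qed.

(** * Classification of the partitions with largest part [h.*2] *)

Lemma unrefinable_excess s h k : sorted ltn s -> all (ltn 0) s ->
  unrefinable s -> last 0 s = h.*2 -> 0 < h -> k.*2 <= h ->
  sumn s = \sum_(1 <= a < h) a + h.*2 + k.*2 ->
  (k.*2 = h /\ s = rcons (iota 1 h) h.*2)
  \/ (s = shift_parts h (shifts h s) /\ sumn (shifts h s) = k).
Proof.
move=> sorted_s pos_s /(unrefinableP _ sorted_s) unref last_s h0 lek sum_s.
have s2h : h.*2 \in s by rewrite -last_s mem_last0 // last_s; lia.
have cover a : 0 < a < h -> (a \in s) || (h.*2 - a \in s).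
  move=> /andP[a0 ltah]; have := unref a (h.*2 - a).
  have -> : a + (h.*2 - a) = h.*2 by lia.
  rewrite s2h; case: (a \in s) => //=; case: (_ \in s) => //= H.
  by apply: H; lia.
(* The excess of a pair over its smaller member: 0 if only [a] is a part, [2(h - a)] if only the
   mirror is, [h.*2 - a] if both are. *)
pose G a := (a \in s) * a + (h.*2 - a \in s) * (h.*2 - a) - a.
have excess : (h \in s) * h + \sum_(1 <= a < h) G a = k.*2.
  move: sum_s; rewrite (sumn_fold _ h) //.
  have -> : \sum_(1 <= a < h) ((a \in s) * a + (h.*2 - a \in s) * (h.*2 - a))
      = \sum_(1 <= a < h) a + \sum_(1 <= a < h) G a.
    rewrite -big_split; apply: eq_big_nat => a lta; rewrite /G /=.
    by have := cover a lta; do 2![case: (_ \in s)] => //=; lia.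
  by lia.
have leG a : 0 < a < h -> (h \in s) * h + G a <= k.*2.
  move=> lta; rewrite -excess leq_add2l.
  by rewrite (bigD1_seq a) ?iota_uniq ?mem_index_iota //= leq_addr.
case sh: (h \in s) leG excess => leG excess; [left | right].
  (* The part [h] alone uses up the whole excess, so every [G a] vanishes and each pair contains
     only its smaller member. *)
  have k2 : k.*2 = h by lia.
  split=> //; have G0 a : 0 < a < h -> (a \in s) && (h.*2 - a \notin s).
    move=> lta; have := cover a lta; have := leG a lta; rewrite /G.
    by do 2![case: (_ \in s)] => //=; lia.
  rewrite [LHS](sorted_ltn_filter_iota s) // last_s.
  apply: (irr_sorted_eq ltn_trans ltnn).
  - exact/(sorted_filter ltn_trans)/iota_ltn_sorted.
  - rewrite (sorted_pairwise ltn_trans) pairwise_rcons.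
    rewrite -(sorted_pairwise ltn_trans) iota_ltn_sorted andbT.
    by apply/allP=> x; rewrite mem_iota /=; lia.
  - move=> x; rewrite mem_filter mem_rcons inE !mem_iota.
    case: (eqVneq x h.*2) => [->|x2h]; first by rewrite s2h; lia.
    case: (ltngtP x h) => [ltxh|ltxh|->]; last by rewrite sh; lia.
    + case: (posnP x) => [->|x0]; first by lia.
      by have /andP[-> _] := G0 x ltac:(lia); lia.
    + have := G0 (h.*2 - x).
      case: (leqP x h.*2) => [lex2h|]; last by lia.
      have -> : h.*2 - (h.*2 - x) = x by lia.
      by case: (x \in s); lia.
(* Two parts in one pair would give [G a = h.*2 - a > h >= k.*2]. *)
have bal a : 0 < a < h -> (a \in s) = (h.*2 - a \notin s).
  move=> lta; have := cover a lta; have := leG a lta; rewrite /G.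
  by do 2![case: (_ \in s)] => //=; lia.
split; first by apply: shifts_shift_parts; rewrite ?sh.
by move: sum_s; rewrite (sumn_balanced _ h) ?sh //; lia.
Qed.

(** * Unrefinability of the shifted partitions *)

Lemma sumn_mem P p : p \in P -> p <= sumn P.
Proof. by move=> Pp; rewrite (perm_sumn (perm_to_rem Pp)) leq_addr. Qed.

Lemma sumn_mem2 P p q : uniq P -> p \in P -> q \in P -> p != q ->
  p + q <= sumn P.
Proof.
move=> uniq_P Pp Pq pq; rewrite (perm_sumn (perm_to_rem Pp)) leq_add2l.
by apply: sumn_mem; rewrite mem_rem_uniq // inE eq_sym pq.
Qed.

(** Of two missing parts [a < b] with [a + b <= h.*2], the smaller is [h - p] with [p] in [P].
    Either [b = h - q] and [p + q <= sumn P], or [b >= h] and [p.*2 < h]; in both cases [a + b - h]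
    is at least [h / 2], too large for [P]. There remains [a + b = h.*2], but then [b = h + p] is a
    part. *)
Lemma shift_parts_unrefinable h P :
  sorted ltn P -> all (ltn 0) P -> (sumn P).*2 <= h ->
  (forall p, p \in P -> p.*2 < h) -> unrefinable (shift_parts h P).
Proof.
move=> sorted_P /allP pos_P leh lth.
have uniq_P : uniq P := sorted_uniq ltn_trans ltnn sorted_P.
apply/unrefinableP; first exact: shift_parts_sorted.
suff wlog_lt a b : 0 < a -> a < b -> a \notin shift_parts h P ->
    b \notin shift_parts h P -> a + b \notin shift_parts h P.
  move=> a b a0 b0; rewrite neq_ltn => /orP[].
    by move=> *; exact: wlog_lt.
  by rewrite addnC => *; exact: wlog_lt.
move=> a0 ltab Ha Hb; apply/negP; move: Ha Hb.
rewrite !mem_shift_parts => Ha Hb /andP[leab].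
have ltah : a < h by lia.
move: Ha; rewrite ltah negb_and negbK.
have -> : 0 < a <= h.*2 by lia.
move=> /= Pa; have /= a'0 := pos_P _ Pa; have leah := lth _ Pa.
move: Hb; have -> : 0 < b <= h.*2 by lia.
case: ltnP => /= ltbh; rewrite !inE ?negbK => Pb.
  have /= := sumn_mem2 _ _ _ uniq_P Pa Pb; have ltbh' := lth _ Pb => sumab.
  have {}sumab : h - a + (h - b) <= sumn P by apply: sumab; lia.
  have -> : a + b < h = false by lia.
  case/predU1P; first by lia.
  by move=> Pq; have := lth _ Pq; lia.
have -> : a + b < h = false by lia.
case/predU1P=> [abh | Pq]; last by have := lth _ Pq; lia.
have eqb : b - h = h - a by lia.
by rewrite eqb Pa orbT in Pb.
Qed.

Lemma sum_nat_1n m : (\sum_(1 <= a < m.+1) a).*2 = m * m.+1.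
Proof.
elim: m => [|m IHm]; first by rewrite (@big_geq _ _ _ 1 1).
by rewrite big_nat_recr //= doubleD IHm; lia.
Qed.

(** * Passage from finite sets to sequences, and the count *)

Lemma mem_image_distinct N s :
  (s \in [seq parts lam | lam in 'D_N]) = is_dpartition N s.
Proof.
apply/imageP/idP=> [[lam] | /is_dpartition_bounded[lam Dlam <-]].
  by rewrite inE => dlam ->.
by exists lam.
Qed.

Lemma mem_image_unrefinable N s :
  (s \in [seq parts lam | lam in 'U_N]) = is_dpartition N s && unrefinable s.
Proof.
apply/imageP/andP=> [[lam] | [/is_dpartition_bounded[lam Dlam <-] unref]].
  by rewrite !inE => /andP[dlam ulam] ->.
by exists lam; rewrite // inE Dlam.
Qed.

Section LargestPartTwiceH.

Variables h k N : nat.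
Hypotheses (k0 : 0 < k) (lek : k.*2 <= h).
Hypothesis defN : N = \sum_(1 <= a < h) a + h.*2 + k.*2.

(** A one-part sequence would sum to [h.*2], which is less than [N] because [0 < k]. *)
Lemma dpartition_size s : sorted ltn s -> all (ltn 0) s -> sumn s = N ->
  last 0 s = h.*2 -> is_dpartition N s.
Proof.
move=> sorted_s pos_s sum_s last_s.
rewrite /is_dpartition sorted_s pos_s sum_s eqxx /=.
by case: s last_s sum_s {sorted_s pos_s} => [|x [|y s]] //=; lia.
Qed.

Lemma shift_parts_dpartition P : sorted ltn P -> all (ltn 0) P -> sumn P = k ->
  (forall p, p \in P -> p.*2 < h) ->
  is_dpartition N (shift_parts h P) && unrefinable (shift_parts h P).
Proof.
move=> sorted_P pos_P sum_P lth.
rewrite shift_parts_unrefinable ?sum_P // andbT.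
apply: dpartition_size; rewrite ?shift_parts_sorted ?shift_parts_gt0 //.
  rewrite sumn_shift_parts ?sum_P //; last by lia.
  by apply/allP=> p /lth /=; lia.
by apply: last_shift_parts; lia.
Qed.

(* The member of [U*_N] that does not come from [D_k]: moving the single part
   [h - k] fails exactly when [h = 2k], since [h - k] and [h] are then distinct
   missing parts with sum [h + k]. *)
Definition exceptional : seq nat :=
  if k.*2 == h then rcons (iota 1 h) h.*2 else shift_parts h [:: k].

Lemma exceptional_dpartition :
  is_dpartition N exceptional && unrefinable exceptional.
Proof.
rewrite /exceptional; case: eqP => [k2h | /eqP k2h]; last first.
  apply: shift_parts_dpartition; rewrite /= ?k0 ?addn0 // => p.
  by rewrite inE => /eqP->; lia.
have sorted_s : sorted ltn (rcons (iota 1 h) h.*2).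
  rewrite (sorted_pairwise ltn_trans) pairwise_rcons.
  rewrite -(sorted_pairwise ltn_trans) iota_ltn_sorted andbT.
  by apply/allP=> x; rewrite mem_iota /=; lia.
apply/andP; split.
  apply: dpartition_size; rewrite ?last_rcons //.
    by apply/allP=> x; rewrite mem_rcons inE mem_iota /=; lia.
  rewrite sumn_rcons sumnE defN; case: h k2h => [|m] k2h; first by lia.
  have -> : iota 1 m.+1 = index_iota 1 m.+2 by rewrite /index_iota subn1.
  by rewrite big_nat_recr //=; lia.
(* All missing numbers exceed [h], so two of them sum past [h.*2]. *)
apply/unrefinableP=> // a b a0 b0 ab.
by rewrite !mem_rcons !inE !mem_iota; lia.
Qed.

Lemma last_exceptional : last 0 exceptional = h.*2.
Proof.
rewrite /exceptional; case: ifP => _; first by rewrite last_rcons.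
by apply: last_shift_parts; lia.
Qed.

(** A second part exists since one-part sequences are excluded. Together with [k.*2 <= h] this gives
    the strict bound [p.*2 < h] that unrefinability of the shift requires. *)
Lemma dpartition_part_lt P p : is_dpartition k P -> p \in P -> p < k.
Proof.
case/and4P=> sorted_P /allP pos_P /eqP sum_P size_P Pp.
have uniq_P : uniq P := sorted_uniq ltn_trans ltnn sorted_P.
suff [q Pq qp] : exists2 q, q \in P & p != q.
  have /= := pos_P q Pq; have := sumn_mem2 _ _ _ uniq_P Pp Pq qp; lia.
case: P size_P uniq_P {sorted_P pos_P sum_P Pp} => [|x [|y P]] //= _.
rewrite inE negb_or -andbA => /and3P[xy _ _].
case: (eqVneq p x) => [->|px]; last by exists x; rewrite ?mem_head.
by exists y; rewrite // !inE eqxx orbT.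
Qed.

Lemma mem_max_unrefinable s :
  [&& is_dpartition N s, unrefinable s & last 0 s == h.*2]
  = (s \in exceptional ::
             [seq shift_parts h P | P <- [seq parts lam | lam in 'D_k]]).
Proof.
apply/and3P/predU1P=> [[dps unref /eqP last_s] | []]; first last.
- case/mapP=> P; rewrite mem_image_distinct => dpP ->.
  have [sorted_P pos_P /eqP sum_P _] := and4P dpP.
  have /andP[] : is_dpartition N (shift_parts h P)
                   && unrefinable (shift_parts h P).
    apply: shift_parts_dpartition => // p /(dpartition_part_lt _ _ dpP); lia.
  by move=> -> ->; rewrite last_shift_parts ?eqxx //; lia.
- move->; have /andP[-> ->] := exceptional_dpartition.
  by rewrite last_exceptional.
have [sorted_s pos_s /eqP sum_s _] := and4P dps.
have h0 : 0 < h by lia.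
have := unrefinable_excess s h k sorted_s pos_s unref last_s h0 lek.
rewrite sum_s defN => /(_ erefl)[[k2h ->] | [def_s sumQ]].
  by left; rewrite /exceptional k2h eqxx.
(* The shifts sum to [k > 0]: either they form an element of ['D_k], or there is only one, equal to
   [k]. *)
case size_Q: (1 < size (shifts h s)).
  right; apply/mapP; exists (shifts h s) => //; rewrite mem_image_distinct.
  by rewrite /is_dpartition shifts_sorted shifts_gt0 sumQ eqxx size_Q.
have defQ : shifts h s = [:: k].
  case: (shifts h s) size_Q sumQ => [|p [|q Q]] //=; first by lia.
  by rewrite addn0 => _ ->.
rewrite defQ in def_s; left; rewrite /exceptional def_s.
case: eqP => // k2h; move/unrefinableP: unref => /(_ sorted_s (h - k) h).
rewrite def_s !mem_shift_parts !inE subnn ltnn.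
have -> : h - k < h by lia.
have -> : h - k + h < h = false by lia.
have -> : h - (h - k) = k by lia.
have -> : h - k + h - h = k by lia.
by rewrite eqxx; lia.
Qed.

Lemma largest_part_max :
  \max_(mu in 'U_N) largest_part (parts mu) = h.*2.
Proof.
(* The right side is the least sum allowed by a largest part beyond [h.*2]; it exceeds [N] by
   [h + 1 - k.*2]. *)
have ltN : N < \sum_(1 <= a < h.+1) a + h.*2.+1.
  by rewrite defN big_nat_recr /=; lia.
apply/eqP; rewrite eqn_leq; apply/andP; split.
  apply/bigmax_leqP=> mu Umu; rewrite leqNgt; apply/negP=> lth.
  have /andP[/and4P[sorted_mu pos_mu /eqP sum_mu _] unref_mu] :
      is_dpartition N (parts mu) && unrefinable (parts mu).
    by rewrite -mem_image_unrefinable; apply/imageP; exists mu.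
  have := unrefinable_last_bound (parts mu) h sorted_mu pos_mu unref_mu lth.
  by rewrite sum_mu; move: lth; rewrite /largest_part; lia.
have := exceptional_dpartition.
rewrite -mem_image_unrefinable => /imageP[lam Ulam def_lam].
rewrite -last_exceptional def_lam.
exact: (leq_bigmax_cond (F := fun mu => largest_part (parts mu)) lam Ulam).
Qed.

(** If [k.*2 = h], the exceptional partition contains [h], which no shifted one does; otherwise its
    shifts are [[:: k]], which has too few parts for ['D_k]. *)
Lemma exceptional_notin :
  exceptional \notin [seq shift_parts h P | P <- [seq parts lam | lam in 'D_k]].
Proof.
apply/mapP=> -[P]; rewrite mem_image_distinct => dpP.
have [sorted_P pos_P /eqP sum_P size_P] := and4P dpP.
have lt_P : all (gtn h) P.
  by apply/allP=> p /(dpartition_part_lt _ _ dpP) /=; lia.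
rewrite /exceptional; case: eqP => [k2h | /eqP k2h] E.
  have : h \in shift_parts h P by rewrite -E mem_rcons inE mem_iota; lia.
  rewrite mem_shift_parts ltnn subnn inE.
  by case P0: (0 \in P); [have /= := allP pos_P 0 P0 | lia].
have := shiftsK h P sorted_P pos_P lt_P; rewrite -E shiftsK //=.
- by move=> defP; rewrite -defP in size_P.
- by rewrite k0.
- by lia.
Qed.

Lemma card_max_unrefinable : #|'U*_N| = 1 + #|'D_k|.
Proof.
rewrite -(size_image (@parts N) 'U*_N) -(size_image (@parts k) 'D_k) add1n.
rewrite -(size_map (shift_parts h) [seq parts lam | lam in 'D_k]).
(* Both sides are now sizes of duplicate-free lists of sequences, so equal membership suffices;
   [shifts h] inverts [shift_parts h] on ['D_k]. *)
apply: (perm_size (s2 := exceptional :: _)).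
apply: uniq_perm.
- by rewrite map_inj_uniq ?enum_uniq //; exact: parts_inj.
- rewrite /= exceptional_notin map_inj_in_uniq.
    by rewrite map_inj_uniq ?enum_uniq //; exact: parts_inj.
  move=> P Q; rewrite !mem_image_distinct => dpP dpQ E.
  have K R : is_dpartition k R -> shifts h (shift_parts h R) = R.
    move=> dpR; have [sorted_R pos_R _ _] := and4P dpR.
    apply: shiftsK => //.
    by apply/allP=> p /(dpartition_part_lt _ _ dpR) /=; lia.
  by rewrite -(K P) // E K.
move=> s; rewrite -mem_max_unrefinable andbA.
apply/imageP/andP=> [[lam] | [+ last_s]].
  rewrite inE largest_part_max => /andP[Ulam last_lam] ->; split=> //.
  by rewrite -mem_image_unrefinable; apply/imageP; exists lam.
rewrite -mem_image_unrefinable => /imageP[lam Ulam def_s].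
by exists lam; rewrite // inE Ulam largest_part_max -def_s.
Qed.

End LargestPartTwiceH.

Theorem theorem3p11 (n k d : nat) (hn : 11 <= n) (hk : 0 < k)
    (hd : d = n - (2 * k - 1)) (hd3 : 3 <= d) (hdn : d <= n - 7) :
  #|'U*_(T_ n d)| = 1 + #|'D_k|.
Proof.
(* For [h = n - 2], the bound [3 <= d] says [k.*2 <= h], and [T_ n d] equals [1 + ... + (n - 3)]
   plus [2(n - 2) + 2k]. *)
apply: (card_max_unrefinable n.-2) => //; first by lia.
have -> : n.-2 = (n - 3).+1 by lia.
by have := sum_nat_1n (n - 3); rewrite /T_; nia.
Qed.
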